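(* Let $S=\langle n_1,n_2,n_3\rangle$ be a numerical semigroup minimally generated by the three elements $n_1,n_2,n_3$. For each $i\in\{1,2,3\}$, with $\{i,j,k\}=\{1,2,3\}$, let $$m_i=\min\{m\in\mathbb{Z}_{\ge 1}: n_i\mid m\text{ and }m\in\langle n_j,n_k\rangle\}.$$ If $m\in S$, then $\chi(\Delta_m)\neq 0$ if and only if $$m\in B=\{0,m_1,m_2,m_3\}\cup\{f+n_1+n_2+n_3 : f\in PF(S)\}.$$
   Context: A numerical semigroup is a subset $S \subseteq \mathbb{Z}_{\ge 0}$ with finite complement that is closed under addition and contains $0$. For positive integers $t_1,\dots,t_r$, $\langle t_1,\ldots,t_r\rangle=\{\alpha_1t_1+\cdots+\alpha_rt_r:\alpha_i\in\mathbb{Z}_{\ge 0}\}$. ''Minimally generated'' means that $n_1,n_2,n_3$ are precisely the irreducible elements of $S$ (positive elements that are not sums of strictly smaller elements of $S$). A pseudo-Frobenius number of $S$ is an $x\in\mathbb{Z}_{\ge 0}\setminus S$ such that $x+s\in S$ for all $s\in S\setminus\{0\}$; $PF(S)$ is the set of all of these. For $F\subseteq[3]=\{1,2,3\}$ write $n_F=\sum_{i\in F}n_i$. For $m\in S$, the squarefree divisor complex of $m$ is the simplicial complex $\Delta_m=\{F\subseteq[3]:m-n_F\in S\}$. The Euler characteristic of a simplicial complex $\Delta$ is $\chi(\Delta)=\sum_{F\in\Delta}(-1)^{|F|}$, where the sum includes the empty face. *)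

(* Defs.v *)
From HB Require Import structures.
From mathcomp Require Import all_boot all_order all_algebra.

Set Implicit Arguments.
Unset Strict Implicit.
Unset Printing Implicit Defensive.

Import GRing.Theory.

Definition numerical_semigroup (S : {pred nat}) : Prop :=
  [/\ 0 \in S,
      forall x y : nat, x \in S -> y \in S -> x + y \in S
    & exists gaps : seq nat, forall x : nat, x \notin S -> x \in gaps].

Definition generated (r : nat) (t : 'I_r -> nat) (x : nat) : Prop :=
  exists a : 'I_r -> nat, x = \sum_(i < r) a i * t i.

Definition irreducible (S : {pred nat}) (x : nat) : Prop :=
  [/\ x \in S, 0 < x
    & ~ exists2 s : seq nat,
          forall y : nat, y \in s -> (y \in S) && (y < x) & x = sumn s].

(* Injectivity of [n] says that the listed generators are pairwise distinct. *)
Definition minimally_generated (S : {pred nat}) (r : nat) (n : 'I_r -> nat)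
    : Prop :=
  [/\ forall x : nat, x \in S <-> generated n x,
      injective n
    & forall x : nat, irreducible S x <-> exists i : 'I_r, x = n i].

Definition pseudo_frobenius (S : {pred nat}) (x : nat) : Prop :=
  x \notin S /\ forall s : nat, s \in S -> s != 0 -> x + s \in S.

Definition nsum (n : 'I_3 -> nat) (F : {set 'I_3}) : nat := \sum_(i in F) n i.

(* Subtraction on [nat] is truncated, hence the guard [nsum n F <= m]. *)
Definition sqfree_divisor_complex (S : {pred nat}) (n : 'I_3 -> nat) (m : nat)
    : {set {set 'I_3}} :=
  [set F : {set 'I_3} | (nsum n F <= m) && (m - nsum n F \in S)].

Definition euler_char (T : finType) (D : {set {set T}}) : int :=
  (\sum_(F in D) (-1) ^+ #|F|)%R.

Definition is_min (P : nat -> Prop) (m : nat) : Prop :=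
  P m /\ forall x : nat, P x -> m <= x.

(* [lift i : 'I_2 -> 'I_3] enumerates the two indices other than [i], so
   [generated (n \o lift i)] is membership in <n_j, n_k>, {i,j,k} = {1,2,3}. *)
Definition common_multiple (n : 'I_3 -> nat) (i : 'I_3) (m : nat) : Prop :=
  [/\ 1 <= m, n i %| m & generated (n \o lift i) m].

Definition in_B (S : {pred nat}) (n mu : 'I_3 -> nat) (m : nat) : Prop :=
  [\/ m = 0,
      exists i : 'I_3, m = mu i
    | exists2 f : nat, pseudo_frobenius S f & m = f + \sum_(i < 3) n i].

(* Main.v *)
Require Import Defs.
From HB Require Import structures.
From mathcomp Require Import all_boot all_order all_algebra.
From mathcomp Require Import zify.

(**
Sort the simplicial complexes on three vertices that contain the empty face by
their graph. The Euler characteristic vanishes exactly on the cones: it is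
nonzero iff there is no vertex, or the graph is disconnected, or the complex is
the boundary of the triangle ([euler_char_neq0]). On three vertices a
disconnected graph has an isolated vertex.

For [Delta_m] everything is read off factorizations [m = sum_i a_i n_i]: [F] is
a face iff some factorization is positive on [F] ([faceP]). The three cases then
become the three parts of [B].

- No vertex means that [m] has no positive coefficient in any factorization,
  that is [m = 0] ([vertexless_eq0]).

- Vertex [i] is isolated iff [m = m_i] ([isolatedE]). If [i] is isolated, then
  a factorization that uses [n_i] uses nothing else, and one that uses another
  generator avoids [n_i]; so [m] is a multiple of [n_i] lying in [<n_j, n_k>].
  It is the least one: if [m_i < m], then [m = (m - m_i) + m_i], with the first
  term written as a multiple of [n_i] and the second in [<n_j, n_k>], is a
  factorization mixing [n_i] with another generator. Conversely a factorization
  of [m_i] that mixes them would leave, after removal of its [n_i] part, a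
  smaller positive common multiple.

- The complex is the boundary of the triangle iff [f = m - (n_1 + n_2 + n_3)] is
  not in [S] while every [f + n_i] is, which is the pseudo-Frobenius condition
  tested on generators ([hollowE]). The only subtlety is that [f] has to be
  nonnegative: if [f < 0] and [n_i] is the smallest generator, then
  [f + n_i < n_i] lies in [S], hence [f = - n_i], and for another generator
  [f + n_j = n_j - n_i] lies in [S], contradicting the irreducibility of [n_j].
*)

Set Implicit Arguments.
Unset Strict Implicit.
Unset Printing Implicit Defensive.

(** * Euler characteristics on three vertices *)

(** A second vertex is required, so that a complex with exactly one vertex,
    whose Euler characteristic is zero, is excluded. *)
Definition isolated (T : finType) (D : {set {set T}}) (i : T) : bool :=
  [&& [set i] \in D,
      [exists j, (j != i) && ([set j] \in D)]
    & [forall j, (j != i) ==> ([set i; j] \notin D)]].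

Definition hollow (T : finType) (D : {set {set T}}) : bool :=
  ([set: T] \notin D) && [forall i, ~: [set i] \in D].

Local Notation v0 := (@Ordinal 3 0 isT).
Local Notation v1 := (@Ordinal 3 1 isT).
Local Notation v2 := (@Ordinal 3 2 isT).

(** The subsets of ['I_3] as bit vectors, so that sums over all subsets and
    membership questions reduce to computation on booleans. *)
Definition set3 (b : bool * bool * bool) : {set 'I_3} :=
  [set i : 'I_3 | nth false [:: b.1.1; b.1.2; b.2] i].

Lemma set3E (F : {set 'I_3}) : F = set3 (v0 \in F, v1 \in F, v2 \in F).
Proof.
apply/setP=> i; rewrite inE.
by case: i => [[|[|[|//]]] lt_i3] /=; congr (_ \in F); apply/val_inj.
Qed.

Lemma set3_bij : bijective set3.
Proof.
exists (fun F : {set 'I_3} => (v0 \in F, v1 \in F, v2 \in F)).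
  by move=> [[a b] c]; rewrite !inE.
by move=> F; rewrite -set3E.
Qed.

Lemma euler_char_set3 (D : {set {set 'I_3}}) :
  let d a b c : int := set3 (a, b, c) \in D in
  euler_char D =
    (d false false false
     - d true false false - d false true false - d false false true
     + d true true false + d true false true + d false true true
     - d true true true)%R.
Proof.
move=> d; rewrite /euler_char big_mkcond (reindex set3) /=; last first.
  exact/onW_bij/set3_bij.
have card3 a b c : #|set3 (a, b, c)| = a + b + c.
  rewrite -sum1_card big_mkcond !big_ord_recl big_ord0 /= !inE /=.
  by case: a; case: b; case: c.
pose t (a b c : bool) : int := ((-1) ^+ (a + b + c) * d a b c)%R.
rewrite (eq_bigr (fun p : bool * bool * bool => t p.1.1 p.1.2 p.2))
  => [|[[a b] c] _ /=]; last first.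
  by rewrite card3 /t /d; case: ifP; rewrite ?GRing.mulr1 ?GRing.mulr0.
rewrite -(pair_bigA _ (fun (p : bool * bool) c => t p.1 p.2 c)) /=.
rewrite -(pair_bigA _ (fun a b : bool => \sum_(c : bool) t a b c)%R) /=.
rewrite !big_bool /t /=; lia.
Qed.

(** The proof is a check of all downward closed families, each encoded by seven
    booleans that tell which nonempty faces it contains. *)
Lemma euler_char_neq0 (D : {set {set 'I_3}}) :
  set0 \in D ->
  (forall F G : {set 'I_3}, G \subset F -> F \in D -> G \in D) ->
  (euler_char D != 0%R) =
    [|| [forall i, [set i] \notin D], [exists i, isolated D i] | hollow D].
Proof.
move=> D0 Dsub.
have forallE (p : pred 'I_3) : [forall i, p i] = [&& p v0, p v1 & p v2].
  apply/forallP/and3P=> [pT // | [p0 p1 p2]] i.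
  by case: i => [[|[|[|//]]] lt_i3]; rewrite (bool_irrelevance lt_i3 isT).
have existsE (p : pred 'I_3) : [exists i, p i] = [|| p v0, p v1 | p v2].
  by apply: negb_inj; rewrite negb_exists forallE !negb_or.
have sub3 a b c a' b' c' : a' ==> a -> b' ==> b -> c' ==> c ->
    (set3 (a, b, c) \in D) ==> (set3 (a', b', c') \in D).
  move=> aP bP cP; apply/implyP/Dsub/subsetP=> i; rewrite !inE.
  by case: i => [[|[|[|//]]] ?] /=; apply/implyP.
have set0E : set0 = set3 (false, false, false) by rewrite [LHS]set3E !inE.
have setTE : setT = set3 (true, true, true) by rewrite [LHS]set3E !inE.
have set1E i : [set i] = set3 (v0 == i, v1 == i, v2 == i).
  by rewrite [LHS]set3E !inE.
have set2E i j : [set i; j] = set3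
    ((v0 == i) || (v0 == j), (v1 == i) || (v1 == j), (v2 == i) || (v2 == j)).
  by rewrite [LHS]set3E !inE.
have setC1E i : ~: [set i] = set3 (v0 != i, v1 != i, v2 != i).
  by rewrite [LHS]set3E !inE.
move: D0; rewrite euler_char_set3 /hollow existsE /isolated !existsE !forallE.
rewrite set0E setTE !set2E !setC1E !set1E /= => ->.
(* Being downward closed in codimension one leaves only the actual complexes. *)
have := @sub3 true true true true true false isT isT isT.
have := @sub3 true true true true false true isT isT isT.
have := @sub3 true true true false true true isT isT isT.
have := @sub3 true true false true false false isT isT isT.
have := @sub3 true true false false true false isT isT isT.
have := @sub3 true false true true false false isT isT isT.
have := @sub3 true false true false false true isT isT isT.
have := @sub3 false true true false true false isT isT isT.
have := @sub3 false true true false false true isT isT isT.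
by do 7![case: (set3 _ \in D) => //=].
Qed.

(** * Factorizations and faces *)

Lemma sum_gt0_coef (r : nat) (a t : 'I_r -> nat) :
  0 < \sum_(i < r) a i * t i -> exists i, 0 < a i.
Proof.
move=> sum_gt0; apply/existsP; apply: contraLR sum_gt0.
rewrite negb_exists => /forallP a0; rewrite big1 // => i _.
by move: (a0 i); rewrite lt0n negbK => /eqP->.
Qed.

Section Complex.

Variables (S : {pred nat}) (n : 'I_3 -> nat).
Hypothesis hn : minimally_generated S n.

Local Notation Delta := (sqfree_divisor_complex S n).
Local Notation value a := (\sum_(i < 3) a i * n i).

Let semigroupE x : x \in S <-> generated n x.
Proof. by case: hn. Qed.

Lemma semigroupD x y : x \in S -> y \in S -> x + y \in S.
Proof.
move=> /semigroupE[a ->] /semigroupE[b ->]; apply/semigroupE.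
exists (fun i => a i + b i); rewrite -big_split.
by apply: eq_bigr => i _; rewrite mulnDl.
Qed.

Lemma generator_irreducible i : irreducible S (n i).
Proof. by case: hn => _ _ irrE; apply/irrE; exists i. Qed.

Lemma generator_in i : n i \in S.
Proof. by case: (generator_irreducible i). Qed.

Lemma generator_gt0 i : 0 < n i.
Proof. by case: (generator_irreducible i). Qed.

(** Otherwise [n j] would be the sum of [n j - n i] and [n i], both smaller. *)
Lemma generator_sub_notin i j : i != j -> n i <= n j -> n j - n i \notin S.
Proof.
case: hn => _ n_inj _ /eqP neq_ij le_ij; apply/negP => subS.
have lt_ij : n i < n j.
  by rewrite ltn_neqAle le_ij andbT; apply/eqP => /n_inj.
case: (generator_irreducible j) => _ _; apply.
exists [:: n j - n i; n i]; last by rewrite /= addn0 subnK.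
have [i0 j0] := (generator_gt0 i, generator_gt0 j).
move=> y; rewrite !inE => /orP[] /eqP->; rewrite ?subS ?generator_in //=; lia.
Qed.

(** Adding [n_F] to a factorization of [m - n_F] makes it positive on [F], and
    conversely; this turns every question on [Delta m] into one on
    coefficients. *)
Lemma faceP m (F : {set 'I_3}) :
  reflect (exists2 a : 'I_3 -> nat, m = value a & forall i, i \in F -> 0 < a i)
          (F \in Delta m).
Proof.
have nsumE : nsum n F = value (fun i => (i \in F) : nat).
  rewrite /nsum big_mkcond; apply: eq_bigr => i _.
  by case: ifP; rewrite ?mul1n ?mul0n.
rewrite inE nsumE; apply: (iffP andP) => [[le_m /semigroupE[b mE]] | [a -> aF]].
  exists (fun i => (i \in F) + b i) => [|i ->//].
  rewrite -(subnKC le_m) mE -big_split /=.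
  by apply: eq_bigr => i _; rewrite mulnDl.
have -> : value a = value (fun i => (i \in F) : nat)
                    + value (fun i => a i - (i \in F)).
  rewrite -big_split /=; apply: eq_bigr => i _; rewrite -mulnDl subnKC //.
  by case: (boolP (i \in F)) => // /aF.
rewrite leq_addr addKn; split=> //; apply/semigroupE.
by exists (fun i => a i - (i \in F)).
Qed.

Lemma vertexP m i :
  reflect (exists2 a : 'I_3 -> nat, m = value a & 0 < a i)
          ([set i] \in Delta m).
Proof.
apply: (iffP (faceP m _)) => [[a mE aF] | [a mE ai]]; exists a => //.
  by apply: aF; rewrite inE.
by move=> j; rewrite inE => /eqP->.
Qed.

Lemma edgeP m i j :
  reflect (exists2 a : 'I_3 -> nat, m = value a & (0 < a i) && (0 < a j))
          ([set i; j] \in Delta m).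
Proof.
apply: (iffP (faceP m _)) => [[a mE aF] | [a mE /andP[ai aj]]]; exists a => //.
  by rewrite !aF // !inE eqxx ?orbT.
by move=> k; rewrite !inE => /orP[] /eqP->.
Qed.

Lemma gt0_has_vertex x : x \in S -> 0 < x -> exists i, [set i] \in Delta x.
Proof.
move=> /semigroupE[a xE]; rewrite {1}xE => /sum_gt0_coef[i ai].
by exists i; apply/vertexP; exists a.
Qed.

Lemma vertexE m i : ([set i] \in Delta m) = (n i <= m) && (m - n i \in S).
Proof. by rewrite inE /nsum big_set1. Qed.

Lemma face_sub m (F G : {set 'I_3}) :
  G \subset F -> F \in Delta m -> G \in Delta m.
Proof.
move=> /subsetP GF /faceP[a mE aF]; apply/faceP.
by exists a => // i /GF; exact: aF.
Qed.

Lemma empty_face m : m \in S -> set0 \in Delta m.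
Proof.
by move=> /semigroupE[a mE]; apply/faceP; exists a => // i; rewrite inE.
Qed.

(** * The three kinds of complexes *)

Lemma vertexless_eq0 m : m \in S ->
  [forall i, [set i] \notin Delta m] = (m == 0).
Proof.
move=> mS; apply/forallP/eqP => [noV | -> i].
  case: (posnP m) => // /(gt0_has_vertex mS)[i].
  by rewrite (negPf (noV i)).
by rewrite vertexE leqNgt generator_gt0.
Qed.

Let valueE i a :
  value a = a i * n i + \sum_(j < 2) a (lift i j) * n (lift i j).
Proof. by rewrite (bigD1_ord i). Qed.

(** The vertex [i] gives a factorization that uses [n i], hence nothing else;
    the second vertex gives one that avoids [n i]. *)
Lemma isolated_common_multiple m i :
  isolated (Delta m) i -> common_multiple n i m.
Proof.
case/and3P=> /vertexP[a maE ai] /existsP[j /andP[ji /vertexP[b mbE bj]]].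
move=> /forallP noedge.
(* A factorization using two generators would be an edge at [i]. *)
have no_mix e k : m = value e -> k != i -> 0 < e i -> 0 < e k -> False.
  move=> mE ki ei ek; case/negP: (implyP (noedge k) ki).
  by apply/edgeP; exists e; rewrite // ei.
have m_ai : m = a i * n i.
  rewrite maE (valueE i) [X in _ + X]big1 ?addn0 // => k _.
  case: (posnP (a (lift i k))) => [->//|ak].
  by case: (no_mix a (lift i k) maE) => //; rewrite eq_sym neq_lift.
have bi : b i = 0 by case: (posnP (b i)) => // bi; case: (no_mix b j).
split; first by rewrite m_ai muln_gt0 ai generator_gt0.
  by rewrite m_ai dvdn_mull.
by exists (b \o lift i); rewrite mbE (valueE i) bi mul0n.
Qed.

(** Minimality of an isolated [m]: writing [m = (m - x) + x] with [m - x] a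
    multiple of [n i] and [x] in [<n_j, n_k>] mixes [n i] with another
    generator. *)
Lemma smaller_common_multiple_edge m x i :
  n i %| m -> common_multiple n i x -> x < m ->
  exists2 j, j != i & [set i; j] \in Delta m.
Proof.
move=> n_m [x_gt0 n_x [c xE]] lt_xm.
have [k ck] : exists k, 0 < c k by move: x_gt0; rewrite xE => /sum_gt0_coef.
have /dvdnP[q mxE] : n i %| m - x by rewrite dvdn_sub.
exists (lift i k); first by rewrite eq_sym neq_lift.
(* Coefficient [q] on [i], and the coefficients of [x] on the other indices. *)
apply/edgeP; exists (fun l => oapp c q (unlift i l)).
  rewrite (valueE i) unlift_none /= -mxE.
  rewrite [X in _ + X](_ : _ = x) ?subnK 1?ltnW // xE.
  by apply: eq_bigr => l _; rewrite liftK.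
rewrite unlift_none liftK /= ck andbT.
by move: lt_xm; rewrite -subn_gt0 mxE muln_gt0 => /andP[].
Qed.

(** Dropping the [n i] part of a factorization that witnesses the edge leaves
    the smaller multiple. *)
Lemma edge_smaller_common_multiple m i j :
  n i %| m -> j != i -> [set i; j] \in Delta m ->
  exists2 x, common_multiple n i x & x < m.
Proof.
move=> n_m ji /edgeP[a mE /andP[ai aj]].
pose tail := \sum_(k < 2) a (lift i k) * n (lift i k).
have m_split : m = a i * n i + tail by rewrite mE (valueE i).
exists tail; last first.
  by rewrite m_split -[X in X < _]add0n ltn_add2r muln_gt0 ai generator_gt0.
split; last by exists (a \o lift i).
  case: (unliftP i j) ji aj => [k -> _ ak|->]; last by rewrite eqxx.
  by rewrite /tail (bigD1 k) //= addn_gt0 muln_gt0 ak generator_gt0.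
by rewrite -(dvdn_addr tail (dvdn_mull (a i) (dvdnn (n i)))) -m_split.
Qed.

Lemma isolatedE m mu_i i : is_min (common_multiple n i) mu_i ->
  isolated (Delta m) i <-> m = mu_i.
Proof.
case=> mu_cm mu_min; split=> [iso | ->].
  have m_cm := isolated_common_multiple iso.
  have [_ n_m _] := m_cm.
  apply/eqP; rewrite eqn_leq mu_min // andbT leqNgt; apply/negP => lt_mu.
  have [j ji edge] := smaller_common_multiple_edge n_m mu_cm lt_mu.
  by case/and3P: iso => _ _ /forallP/(_ j); rewrite ji edge.
have [mu_gt0 n_mu [c muE]] := mu_cm.
have /dvdnP[d mu_d] := n_mu.
apply/and3P; split.
- apply/vertexP; exists (fun k => if k == i then d else 0).
    rewrite (valueE i) eqxx -mu_d big1 ?addn0 // => k _.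
    by rewrite eq_sym (negPf (neq_lift _ _)).
  by move: mu_gt0; rewrite eqxx mu_d muln_gt0 => /andP[].
- have [k ck] : exists k, 0 < c k by move: mu_gt0; rewrite muE => /sum_gt0_coef.
  apply/existsP; exists (lift i k); rewrite eq_sym neq_lift /=.
  apply/vertexP; exists (fun l => oapp c 0 (unlift i l)); last by rewrite liftK.
  rewrite (valueE i) unlift_none /= mul0n muE.
  by apply: eq_bigr => l _; rewrite liftK.
apply/forallP => j; apply/implyP => ji; apply/negP => edge.
have [x x_cm] := edge_smaller_common_multiple n_mu ji edge.
by apply/negP; rewrite -leqNgt mu_min.
Qed.

(** Every nonzero element of [S] is a generator plus an element of [S]. *)
Lemma pseudo_frobenius_generators f :
  f \notin S -> (forall i, f + n i \in S) -> pseudo_frobenius S f.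
Proof.
move=> fNS fnS; split=> // s sS; rewrite -lt0n => /(gt0_has_vertex sS)[i].
rewrite vertexE => /andP[le_is subS].
by rewrite -(subnKC le_is) addnA; apply: semigroupD.
Qed.

Lemma hollowE m :
  hollow (Delta m) <->
  exists2 f, pseudo_frobenius S f & m = f + \sum_(i < 3) n i.
Proof.
pose N := \sum_(i < 3) n i; rewrite -/N.
have nsumT : nsum n setT = N by apply: eq_bigl => i; rewrite inE.
have nsumC i : nsum n (~: [set i]) + n i = N.
  rewrite /N (bigD1 i) //= addnC; congr (_ + _).
  by apply: eq_bigl => j; rewrite !inE.
rewrite /hollow; split; last first.
  case=> f [fNS fS] mE; apply/andP; split.
    by rewrite inE nsumT mE leq_addl addnK.
  apply/forallP=> i; rewrite inE mE -(nsumC i) addnCA leq_addr addKn.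
  by apply: fS; [exact: generator_in | rewrite -lt0n generator_gt0].
case/andP=> noT /forallP faces.
have le_N i : N <= m + n i.
  by move: (faces i); rewrite inE -(nsumC i) leq_add2r => /andP[].
have diffS i : m + n i - N \in S.
  by move: (faces i); rewrite inE -(nsumC i) subnDr => /andP[].
have [le_Nm | lt_mN] := leqP N m.
  exists (m - N); last by rewrite subnK.
  apply: pseudo_frobenius_generators => [|i]; last by rewrite addnBAC.
  by move: noT; rewrite inE nsumT le_Nm.
(* Otherwise [m - N] is negative; adding the smallest [n i] gives an element of
   [S] below every generator, which must be zero. *)
have [i _ min_i] := arg_minnP n (erefl : predT (ord0 : 'I_3)).
have mNi : m + n i = N.
  apply/eqP; rewrite eqn_leq le_N andbT leqNgt; apply/negP => lt_N.
  have [k] : exists k, [set k] \in Delta (m + n i - N).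
    by apply: gt0_has_vertex; rewrite // subn_gt0.
  by rewrite vertexE => /andP[le_k _]; have := min_i k isT; lia.
have /generator_sub_notin/(_ (min_i _ isT)) /negP[] : i != lift i ord0.
  exact: neq_lift.
by have := diffS (lift i ord0); rewrite -mNi subnDl.
Qed.

End Complex.

(** * The theorem *)

Theorem theorem3p5 (S : {pred nat}) (n mu : 'I_3 -> nat) (m : nat)
  (hS : numerical_semigroup S)
  (hn : minimally_generated S n)
  (hmu : forall i : 'I_3, is_min (common_multiple n i) (mu i))
  (hm : m \in S) :
  euler_char (sqfree_divisor_complex S n m) != 0%R <-> in_B S n mu m.
Proof.
rewrite euler_char_neq0; first last.
- by move=> F G; apply: face_sub.
- exact: (empty_face hn hm).
rewrite (vertexless_eq0 hn) //; split.
- case/or3P=> [/eqP | /existsP[i] | ] mP; first exact: Or31.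
    by apply: Or32; exists i; exact/(isolatedE hn m (hmu i)).
  by apply: Or33; exact/(hollowE hn).
case=> [-> // | [i /(isolatedE hn m (hmu i)) iso] | /(hollowE hn) hol].
  by apply/or3P/Or32/existsP; exists i.
exact/or3P/Or33.
Qed.
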